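(* Let $X\in\mathbb{R}^{n\times p}$ be deterministic with $\|X_j\|_2^2=n$ for all $j\in[p]$, let $\beta^*\in\mathbb{R}^p$, $\sigma>0$, and $y=X\beta^*+\varepsilon$ with $\varepsilon\sim\mathcal{N}(0,\sigma^2I_n)$. Let $\delta\in(0,1)$ be arbitrary and $\lambda=2\sigma\sqrt{2\log(p/\delta)/n}$. Let $\hat\beta$ be a Lasso solution with tuning parameter $\lambda$ and let $\bar\beta$ be a refitting of the Lasso solution $\hat\beta$. Then with probability at least $1-\delta$, $$\frac1n\|X(\beta^*-\bar\beta)\|_2^2\le\frac1n\|X(\beta^*-\hat\beta)\|_2^2+\lambda\|\bar\beta-\hat\beta\|_1 .$$
   Context: $[p]=\{1,\dots,p\}$; $X_j$ is the $j$-th column of $X$. A Lasso solution with tuning parameter $\lambda>0$ is any $\hat\beta\in\arg\min_{\beta\in\mathbb{R}^p}\frac{1}{2n}\|y-X\beta\|_2^2+\lambda\|\beta\|_1$. A vector $\bar\beta=\bar\beta(\hat\beta,X,y)$ is called a refitting of the Lasso solution $\hat\beta$ if $\|y-X\bar\beta\|_2\le\|y-X\hat\beta\|_2$. *)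

(* Defs.v *)
From HB Require Import structures.
From mathcomp Require Import all_boot all_order all_algebra.
From mathcomp Require Import all_classical all_reals all_analysis.
Set Implicit Arguments.
Unset Strict Implicit.
Unset Printing Implicit Defensive.
Import Order.TTheory GRing.Theory Num.Theory.
Local Open Scope classical_set_scope.
Local Open Scope ring_scope.

(* The norm `|v| that the library puts on matrices is the sup norm, so the
   l1 and l2 norms of a column vector are defined separately. *)
Definition l2norm (R : realType) (m : nat) (v : 'cV[R]_m) : R :=
  Num.sqrt (\sum_i v i ord0 ^+ 2).

Definition l1norm (R : realType) (m : nat) (v : 'cV[R]_m) : R :=
  \sum_i `|v i ord0|.

Definition lasso_objective (R : realType) (n p : nat) (X : 'M[R]_(n, p))
    (y : 'cV[R]_n) (lambda : R) (b : 'cV[R]_p) : R :=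
  (2 * n%:R)^-1 * l2norm (y - X *m b) ^+ 2 + lambda * l1norm b.

Definition is_lasso_solution (R : realType) (n p : nat) (X : 'M[R]_(n, p))
    (y : 'cV[R]_n) (lambda : R) (bhat : 'cV[R]_p) : Prop :=
  forall b : 'cV[R]_p,
    lasso_objective X y lambda bhat <= lasso_objective X y lambda b.

Definition is_refitting (R : realType) (n p : nat) (X : 'M[R]_(n, p))
    (y : 'cV[R]_n) (bhat bbar : 'cV[R]_p) : Prop :=
  l2norm (y - X *m bbar) <= l2norm (y - X *m bhat).

Definition mutually_independent (d : measure_display) (T : measurableType d)
    (R : realType) (P : probability T R) (I : finType)
    (Z : I -> {RV P >-> R}) : Prop :=
  forall (J : {set I}) (B : I -> set R),
    (forall i, i \in J -> measurable (B i)) ->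
    P [set w | forall i, i \in J -> B i (Z i w)] =
      (\prod_(i in J) P (Z i @^-1` B i))%E.

(* The law N(0, sigma^2 I_n), as n mutually independent coordinates each with
   law N(0, sigma^2). The second argument of [normal_prob] is the standard
   deviation, not the variance. *)
Definition isotropic_gaussian (d : measure_display) (T : measurableType d)
    (R : realType) (P : probability T R) (n : nat) (sigma : R)
    (eps : 'I_n -> {RV P >-> R}) : Prop :=
  (forall (i : 'I_n) (A : set R), measurable A ->
      distribution P (eps i) A = normal_prob 0 sigma A) /\
  mutually_independent eps.

(* The event E need not be measurable (minimizers and refittings may be selected
   non-measurably), so the bound is required of a measurable subset of E; for
   measurable E this is q <= P E, see [with_prob_geP]. *)
Definition with_prob_ge (d : measure_display) (T : measurableType d)
    (R : realType) (P : probability T R) (q : R) (E : set T) : Prop :=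
  exists A : set T, [/\ measurable A, A `<=` E & (q%:E <= P A)%E].

Lemma with_prob_geP (d : measure_display) (T : measurableType d)
    (R : realType) (P : probability T R) (q : R) (E : set T) :
  measurable E -> with_prob_ge P q E <-> (q%:E <= P E)%E.
Proof.
move=> mE; split => [[A [mA AE qA]]|qE]; last by exists E; split.
by apply: (le_trans qA); apply: le_measure; rewrite ?inE.
Qed.

(* Main.v *)
(* Expanding [|y - X b|^2] in the refitting inequality gives
   [|X(b* - bbar)|^2 <= |X(b* - bhat)|^2 + 2 <X^T eps, bbar - bhat>], and on the
   event [|X^T eps|_oo <= n lambda / 2] the last term is at most
   [n lambda |bbar - bhat|_1].  Each [<X_j, eps>] is N(0, n sigma^2), and the
   sharp tail [P(|Z| > t) <= exp(- t^2 / 2)] of a standard Gaussian, without the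
   factor 2 of the Chernoff bound, makes the union bound over the [p] columns
   add up to exactly [delta]. *)

Require Import Defs.
From HB Require Import structures.
From mathcomp Require Import all_boot all_order all_algebra.
From mathcomp Require Import all_classical all_reals all_analysis.
From mathcomp Require Import measurable_realfun ring lra.
Set Implicit Arguments.
Unset Strict Implicit.
Unset Printing Implicit Defensive.
Import Order.TTheory GRing.Theory Num.Theory.
Local Open Scope classical_set_scope.
Local Open Scope ring_scope.

Local Notation mu := lebesgue_measure.

(** * Translation invariance and integration against a normal law *)

(** The translated measure agrees with Lebesgue measure on half-open intervals, which determines
    it. *)
Lemma lebesgue_measure_shift (R : realType) (c : R) (A : set R) :
  measurable A ->
  pushforward mu ((fun x => x + c) : _ -> measurableTypeR R) A = mu A.
Proof.
move=> mA.
pose f : measurableTypeR R -> measurableTypeR R := fun x => x + c.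
have mf : measurable_fun setT f by exact: measurable_funD.
apply/esym.
apply: (@lebesgue_measure_unique R (pushforward mu f)) => //= _ [[a b]] _ <-.
rewrite /pushforward (_ : _ @^-1` _ = `]a - c, b - c]%classic); last first.
  by apply/seteqP; split => x/=; rewrite !in_itv/= ltrBlDr lerBrDr.
by rewrite !lebesgue_measure_itv/= !lte_fin ltrD2r -!EFinB opprB addrA subrK.
Qed.

Lemma ge0_integral_shift (R : realType) (c : R) (f : R -> \bar R) :
  measurable_fun setT f -> (forall x, 0 <= f x)%E ->
  (\int[mu]_x f (x + c)%R = \int[mu]_x f x)%E.
Proof.
move=> mf f0.
have mD : measurable_fun setT
    ((fun x => x + c) : measurableTypeR R -> measurableTypeR R).
  exact: measurable_funD.
have := @ge0_integral_pushforward _ _ _ _ R _ mD mu setT f measurableT mf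
  (fun y _ => f0 y).
rewrite preimage_setT => <-.
by apply: eq_measure_integral => A mA _; exact: lebesgue_measure_shift.
Qed.

(** Change of variables is available for the Radon-Nikodym derivative. That derivative equals the
    normal density almost everywhere, since both have the same integral over every measurable
    set. *)
Lemma ge0_integral_normal_prob (R : realType) (m s : R) (f : R -> \bar R) :
  measurable_fun setT f -> (forall x, 0 <= f x)%E ->
  (\int[normal_prob m s]_x f x =
   \int[mu]_x (f x * (normal_pdf m s x)%:E))%E.
Proof.
move=> mf f0.
have dom := normal_prob_dominates m s.
rewrite -(Radon_Nikodym_SigmaFinite.change_of_variables dom)//=.
have mg := Radon_Nikodym_SigmaFinite.f_integrable dom.
apply: ae_eq_integral => //.
- by apply: emeasurable_funM => //; exact: measurable_int mg.
- apply: emeasurable_funM => //; apply/measurable_EFinP.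
  exact: measurable_normal_pdf.
- apply: ae_eqe_mul2l; apply: integral_ae_eq => //.
    by apply/measurable_EFinP; exact: measurable_normal_pdf.
  by move=> E _ mE; rewrite -Radon_Nikodym_SigmaFinite.f_integral.
Qed.

Lemma normal_probE (R : realType) (m s : R) (B : set R) : measurable B ->
  normal_prob m s B = (\int[mu]_x ((\1_B x)%:E * (normal_pdf m s x)%:E))%E.
Proof.
move=> mB; rewrite -ge0_integral_normal_prob//.
- by rewrite integral_indic ?setIT.
- exact/measurable_EFinP/measurable_indic.
Qed.

(** * Convolution of centred normal laws *)

Lemma normal_peakE (R : realType) (s : R) : 0 <= s ->
  normal_peak s = (s * Num.sqrt (pi *+ 2))^-1.
Proof.
by move=> s0; rewrite /normal_peak -mulrnAr sqrtrM ?sqr_ge0// sqrtr_sqr ger0_norm.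
Qed.

(* For independent U ~ N(0, s^2), V ~ N(0, t^2) and W = U + c V, this factors the
   joint density of (V, W) into that of W and the conditional one of V. *)
Lemma normal_pdfM (R : realType) (s t q c v w : R) :
  0 < s -> 0 < t -> 0 < q -> q ^+ 2 = s ^+ 2 + c ^+ 2 * t ^+ 2 ->
  normal_pdf 0 t v * normal_pdf 0 s (w - c * v) =
  normal_pdf 0 q w * normal_pdf (c * t ^+ 2 * w / q ^+ 2) (s * t / q) v.
Proof.
move=> s0 t0 q0 qE.
have r0 : 0 < s * t / q by rewrite divr_gt0// mulr_gt0.
rewrite !normal_pdfE ?gt_eqF// mulrACA [RHS]mulrACA; congr (_ * _).
  rewrite !normal_peakE ?ltW//.
  have : Num.sqrt (pi *+ 2) != 0 :> R.
    by rewrite gt_eqF// sqrtr_gt0 mulrn_wgt0// pi_gt0.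
  by move=> h; field; rewrite h !gt_eqF.
rewrite /normal_fun -!expRD; congr expR.
by rewrite !subr0; field : qE; rewrite !gt_eqF.
Qed.

Lemma measurable_preimageT d d' (T : measurableType d) (T' : measurableType d')
    (f : T -> T') (B : set T') :
  measurable_fun setT f -> measurable B -> measurable (f @^-1` B).
Proof. by move=> mf mB; rewrite -[X in measurable X]setTI; exact: mf. Qed.

(** Both laws are written with their densities and the inner integral is translated to the variable
    w = u + c v. After Tonelli, [normal_pdfM] leaves the density of w times a density in v, and the
    latter integrates to 1. *)
Lemma normal_prob_convolution (R : realType) (s t q c : R) (B : set R) :
  0 < s -> 0 < t -> 0 < q -> q ^+ 2 = s ^+ 2 + c ^+ 2 * t ^+ 2 ->
  measurable B ->
  (\int[normal_prob 0 t]_v normal_prob 0 s [set u | B (u + c * v)%R] =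
   normal_prob 0 q B)%E.
Proof.
move=> s0 t0 q0 qE mB.
have mpdf (m z : R) d (T : measurableType d) (f : T -> R) :
    measurable_fun setT f ->
    measurable_fun setT (fun x => (normal_pdf m z (f x))%:E).
  move=> mf; apply/measurable_EFinP.
  by apply: (measurableT_comp (measurable_normal_pdf _ _)).
(* With z = (v, w), this is the joint density of (V, W) cut down to w in [B]. *)
pose f (z : R * R) : \bar R :=
  ((\1_B z.2)%:E * (normal_pdf 0 s (z.2 - c * z.1) * normal_pdf 0 t z.1)%:E)%E.
have f0 z : (0 <= f z)%E.
  by rewrite mule_ge0// lee_fin// mulr_ge0// normal_pdf_ge0.
have mf : measurable_fun setT f.
  apply: emeasurable_funM; last first.
    under eq_fun do rewrite EFinM.
    apply: emeasurable_funM; last exact: mpdf.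
    by apply: mpdf; apply: measurable_funB => //; apply: measurable_funM.
  apply/measurable_EFinP.
  by apply: (measurableT_comp (measurable_indic _)).
have inner v : normal_prob 0 s [set u | B (u + c * v)] =
    (\int[mu]_w ((\1_B w)%:E * (normal_pdf 0 s (w - c * v))%:E))%E.
  rewrite normal_probE; last first.
    have -> : [set u | B (u + c * v)] = (fun u => u + c * v) @^-1` B by [].
    by apply: measurable_preimageT mB; apply: measurable_funD.
  rewrite -[RHS](ge0_integral_shift (c * v)).
  - by apply: eq_integral => u _; rewrite addrK.
  - apply: emeasurable_funM; last by apply: mpdf; apply: measurable_funB.
    by apply/measurable_EFinP/measurable_indic.
  - by move=> w; rewrite mule_ge0// lee_fin// normal_pdf_ge0.
have minner v : measurable_fun setT
    (fun w => (\1_B w)%:E * (normal_pdf 0 s (w - c * v))%:E)%E.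
  apply: emeasurable_funM; last by apply: mpdf; apply: measurable_funB.
  by apply/measurable_EFinP/measurable_indic.
have inner0 v w :
    (0 <= (\1_B w)%:E * (normal_pdf 0 s (w - c * v))%:E :> \bar R)%E.
  by rewrite mule_ge0// lee_fin// normal_pdf_ge0.
under eq_integral do rewrite inner.
rewrite ge0_integral_normal_prob; last 2 first.
(* Measurability in v of the inner integral comes from Tonelli applied to the joint integrand
   [g]. *)
- pose g (z : R * R) : \bar R :=
    ((\1_B z.2)%:E * (normal_pdf 0 s (z.2 - c * z.1))%:E)%E.
  have g0 z : (0 <= g z)%E by rewrite mule_ge0// lee_fin// normal_pdf_ge0.
  have mg : measurable_fun setT g.
    apply: emeasurable_funM; last first.
      by apply: mpdf; apply: measurable_funB => //; apply: measurable_funM.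
    apply/measurable_EFinP.
    by apply: (measurableT_comp (measurable_indic _)).
  exact: (measurable_fun_fubini_tonelli_F (m2 := mu) g mg g0).
- by move=> v; apply: integral_ge0.
transitivity (\int[mu]_v \int[mu]_w f (v, w))%E.
  apply: eq_integral => v _; rewrite -ge0_integralZr//.
  - by apply: eq_integral => w _; rewrite /f/= EFinM muleA.
  - exact: minner.
  - by rewrite lee_fin normal_pdf_ge0.
rewrite (fubini_tonelli (m1 := mu) (m2 := mu) f)// normal_probE//.
apply: eq_integral => w _.
(* The factor 1 is rewritten as the total mass of the conditional law of v given w. *)
rewrite -[RHS]mule1 -(integral_normal_pdf (c * t ^+ 2 * w / q ^+ 2) (s * t / q)).
rewrite -ge0_integralZl//.
- apply: eq_integral => v _.
  by rewrite /f/= mulrC (normal_pdfM _ _ s0 t0 q0 qE) EFinM muleA.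
- by apply: mpdf.
- by move=> v _; rewrite lee_fin normal_pdf_ge0.
- by rewrite mule_ge0// lee_fin// normal_pdf_ge0.
Qed.

(** * Sharp two-sided tail of a normal law *)

(* [(x + c)^2 >= x^2 + c^2] on [B].  Using this on both half-lines, rather than
   an exponential moment, is what yields constant 1 in the two-sided tail. *)
Lemma normal_prob_shift_le (R : realType) (s c : R) (B : set R) :
  0 < s -> measurable B -> (forall x, B x -> 0 <= x * c) ->
  (normal_prob 0 s [set x | B (x - c)%R] <=
   (expR (- c ^+ 2 / (s ^+ 2 *+ 2)))%:E * normal_prob 0 s B)%E.
Proof.
move=> s0 mB Bc.
have mpdf (f : R -> R) : measurable_fun setT f ->
    measurable_fun setT (fun x => (normal_pdf 0 s (f x))%:E).
  move=> mf; apply/measurable_EFinP.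
  by apply: (measurableT_comp (measurable_normal_pdf _ _)).
have mI : measurable_fun setT (fun x : R => (\1_B x)%:E : \bar R).
  by apply/measurable_EFinP/measurable_indic.
rewrite !normal_probE//; last first.
  have -> : [set u | B (u - c)] = (fun u => u - c) @^-1` B by [].
  by apply: measurable_preimageT mB; apply: measurable_funB.
(* Chosen so that the integrand on the left is f (x - c); translation then puts both integrals over
   [B]. *)
pose f x : \bar R := ((\1_B x)%:E * (normal_pdf 0 s (x + c))%:E)%E.
have f0 x : (0 <= f x)%E by rewrite mule_ge0// lee_fin// normal_pdf_ge0.
have mf : measurable_fun setT f.
  by apply: emeasurable_funM => //; apply: mpdf; apply: measurable_funD.
rewrite (_ : (\int[mu]_x _)%E = (\int[mu]_x f (x - c)%R)%E); last first.
  by apply: eq_integral => x _; rewrite /f subrK.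
rewrite (ge0_integral_shift (- c))//.
have mg : measurable_fun setT
    (fun x : R => (\1_B x)%:E * (normal_pdf 0 s x)%:E : \bar R)%E.
  by apply: emeasurable_funM => //; apply: mpdf.
have g0 x : (0 <= (\1_B x)%:E * (normal_pdf 0 s x)%:E :> \bar R)%E.
  by rewrite mule_ge0// lee_fin// normal_pdf_ge0.
rewrite -ge0_integralZl//.
apply: ge0_le_integral => //.
- by apply: emeasurable_funM => //.
- move=> x _; rewrite /f muleCA indicE.
  have [xB|xB] := boolP (x \in B); last by rewrite !mul0e.
  rewrite !mul1e -EFinM lee_fin !normal_pdfE ?gt_eqF// mulrCA.
  rewrite ler_wpM2l ?normal_peak_ge0// /normal_fun -expRD ler_expR -mulrDl.
  rewrite ler_wpM2r ?invr_ge0 ?mulrn_wge0 ?sqr_ge0// !subr0.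
  have := Bc x (set_mem xB); nra.
Qed.

(** The two tails are the half-lines at 0 moved outwards by [t]. Each move costs the same
    exponential factor, which multiplies the total mass of the two half-lines. *)
Lemma normal_prob_tail (R : realType) (s t : R) : 0 < s -> 0 <= t ->
  (normal_prob 0 s [set x | (t < `|x|)%R] <=
   (expR (- t ^+ 2 / (s ^+ 2 *+ 2)))%:E)%E.
Proof.
move=> s0 t0.
have mlt a : measurable [set x : R | a < x].
  rewrite [mkset _](_ : _ = `]a, +oo[%classic); first exact: measurable_itv.
  by apply/seteqP; split => x/=; rewrite in_itv/= andbT.
have mgt a : measurable [set x : R | x < a].
  rewrite [mkset _](_ : _ = `]-oo, a[%classic); first exact: measurable_itv.
  by apply/seteqP; split => x/=; rewrite in_itv/=.
have -> : [set x | t < `|x|] =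
    [set x | 0 < x - t] `|` [set x | x - - t < 0].
  apply/funext => x; apply/propext => /=; rewrite ltr_normr subr_gt0 opprK.
  by rewrite -[x + t]opprK opprD ltrNl oppr0 subr_gt0; split => /orP.
apply: (le_trans (measureU2 _ _ _)) => //.
- by under eq_set do rewrite subr_gt0; exact: mlt.
- by under eq_set do rewrite subr_lt0; exact: mgt.
apply: (@le_trans _ _ ((expR (- t ^+ 2 / (s ^+ 2 *+ 2)))%:E *
    (normal_prob 0 s [set x | 0 < x]%R + normal_prob 0 s [set x | x < 0]%R))%E).
  rewrite ge0_muleDr//; apply: leeD.
    apply: (@normal_prob_shift_le _ s t [set x | 0 < x]) => // x /= x0.
    by rewrite mulr_ge0// ltW.
  rewrite -(sqrrN t).
  apply: (@normal_prob_shift_le _ s (- t) [set x | x < 0]) => // x /= x0.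
  by rewrite mulrN oppr_ge0 mulr_le0_ge0// ltW.
(* The half-lines are disjoint, so their masses add up to at most 1 and no factor 2 appears. *)
rewrite -[leRHS]mule1 lee_wpmul2l ?lee_fin ?expR_ge0//.
rewrite -measureU; [|exact: mlt|exact: mgt|].
  by apply: probability_le1; apply: measurableU; [exact: mlt|exact: mgt].
by apply/seteqP; split => x //= [] /lt_trans/[apply]; rewrite ltxx.
Qed.

(** * Linear combinations of independent normal variables *)

(** On [E], the pair (Y, X) has a product law scaled by P E, so the claim reduces to
    [normal_prob_convolution]. Keeping [E] in the statement lets it be iterated. *)
Lemma normal_sum_restr (R : realType) d (T : measurableType d)
    (P : probability T R) (E : set T) (X Y : T -> R) (s t q c : R) :
  measurable E -> measurable_fun setT X -> measurable_fun setT Y ->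
  0 < s -> 0 < t -> 0 < q -> q ^+ 2 = s ^+ 2 + c ^+ 2 * t ^+ 2 ->
  (forall A B, measurable A -> measurable B ->
    P (X @^-1` A `&` (Y @^-1` B `&` E)) =
    (normal_prob 0 s A * (normal_prob 0 t B * P E))%E) ->
  forall B, measurable B ->
    P ((fun w => X w + c * Y w)%R @^-1` B `&` E) = (normal_prob 0 q B * P E)%E.
Proof.
move=> mE mX mY s0 t0 q0 qE XY B mB.
have PE : P E = (fine (P E))%:E by rewrite fineK// fin_num_measure.
(* The mass of [E] is absorbed into one factor of the product measure; this avoids conditioning,
   hence division by a possibly zero P E. *)
pose r : {nonneg R} := NngNum (fine_ge0 (measure_ge0 P E)).
have rE : P E = r%:num%:E by exact: PE.
pose Z (w : T) : measurableTypeR R * measurableTypeR R := (Y w, X w).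
have mZ : measurable_fun setT Z by exact: measurable_fun_pair.
pose m1 := normal_prob 0 t.
pose m2 := mscale r (normal_prob 0 s).
pose C : set (measurableTypeR R * measurableTypeR R) :=
  [set z | B (z.2 + c * z.1)].
have mC : measurable C.
  have -> : C = (fun z : R * R => z.2 + c * z.1) @^-1` B by [].
  apply: measurable_preimageT mB; apply: measurable_funD => //.
  exact: measurable_funM.
have /(_ mZ) h := @product_measure_unique _ _ _ _ R m1 m2
  (pushforward (mrestr P mE) Z).
transitivity ((m1 \x m2)%E C); first rewrite h// => A D mA mD.
  transitivity (P ((X @^-1` D `&` Y @^-1` A) `&` E)).
    by congr (P (_ `&` E)); apply/seteqP; split => w [].
  rewrite -setIA XY// muleCA; congr (_ * _)%E.
  by rewrite muleC rE.
rewrite -(normal_prob_convolution s0 t0 q0 qE mB).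
have sec v : [set u | B (u + c * v)] = xsection C v.
  by apply/seteqP; split => u /=; rewrite /xsection /= inE.
under eq_integral do rewrite sec.
rewrite muleC rE -ge0_integralZl//.
exact: (measurable_fun_xsection (normal_prob 0 s) mC).
Qed.

Definition coord_event d (T : measurableType d) (R : realType)
    (P : probability T R) (I : finType) (Z : I -> {RV P >-> R})
    (J : {set I}) (B : I -> set R) : set T :=
  [set w | forall i, i \in J -> B i (Z i w)].

Lemma measurable_coord_event d (T : measurableType d) (R : realType)
    (P : probability T R) (I : finType) (Z : I -> {RV P >-> R})
    (J : {set I}) (B : I -> set R) :
  (forall i, measurable (B i)) -> measurable (coord_event Z J B).
Proof.
move=> mB.
rewrite (_ : coord_event _ _ _ = \bigcap_(i in [set` J]) (Z i @^-1` B i)).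
  apply: fin_bigcap_measurable => // i _.
  exact: measurable_funPTI.
by apply/seteqP; split => w /=.
Qed.

Lemma coord_eventU1 d (T : measurableType d) (R : realType)
    (P : probability T R) (I : finType) (Z : I -> {RV P >-> R})
    (j : I) (J : {set I}) (A : set R) (B : I -> set R) : j \notin J ->
  Z j @^-1` A `&` coord_event Z J B =
  coord_event Z (j |: J) (fun i => if i == j then A else B i).
Proof.
move=> jJ; apply/seteqP; split => w /=.
  move=> [Aw Jw] i; rewrite in_setU1.
  by case: eqVneq => [->//|_ /=]; exact: Jw.
move=> h; split; first by have := h j; rewrite setU11 eqxx; exact.
move=> i iJ; have := h i; rewrite in_setU1 iJ orbT.
by case: eqVneq iJ jJ => [-> ->//|_ _ _]; exact.
Qed.

(** Independence is applied over [j |: J] and over [J]; the two products differ only by the factor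
    at [j]. *)
Lemma isotropic_gaussian_setU1 (R : realType) d (T : measurableType d)
    (P : probability T R) (n : nat) (sigma : R) (eps : 'I_n -> {RV P >-> R})
    (j : 'I_n) (J : {set 'I_n}) (B : 'I_n -> set R) (A : set R) :
  isotropic_gaussian sigma eps -> j \notin J ->
  (forall i, measurable (B i)) -> measurable A ->
  P (eps j @^-1` A `&` coord_event eps J B) =
  (normal_prob 0 sigma A * P (coord_event eps J B))%E.
Proof.
move=> [law indep] jJ mB mA; rewrite coord_eventU1// /coord_event.
pose B' i := if i == j then A else B i.
rewrite (indep (j |: J) B') => [|i _]; last by rewrite /B'; case: ifP.
rewrite (indep J B)// big_setU1//= /B' eqxx; congr (_ * _)%E; first exact: law.
apply: eq_bigr => i iJ.
by case: eqVneq iJ jJ => [-> ->|].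
Qed.

(* The event on the coordinates in [J] carries the independence needed by the
   induction on [l].  The coefficient 1 of [eps j] keeps the standard deviation
   positive: [normal_prob 0 0] is the uniform law on [0, 1], not a Dirac mass. *)
Lemma normal_linear_comb (R : realType) d (T : measurableType d)
    (P : probability T R) (n : nat) (sigma : R) (eps : 'I_n -> {RV P >-> R})
    (c : 'I_n -> R) (j : 'I_n) (l : seq 'I_n) (J : {set 'I_n})
    (B : 'I_n -> set R) (A : set R) :
  0 < sigma -> isotropic_gaussian sigma eps ->
  uniq (j :: l) -> {in J, forall i, i \notin j :: l} ->
  (forall i, measurable (B i)) -> measurable A ->
  P ((fun w => eps j w + \sum_(i <- l) c i * eps i w) @^-1` A `&`
     coord_event eps J B) =
  (normal_prob 0 (sigma * Num.sqrt (1 + \sum_(i <- l) c i ^+ 2)) A *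
   P (coord_event eps J B))%E.
Proof.
move=> s0 iso; elim: l J B A => [|k l IH] J B A ul lJ mB mA.
  rewrite !big_nil addr0 sqrtr1 mulr1.
  under eq_fun do rewrite big_nil addr0.
  apply: isotropic_gaussian_setU1 => //.
  by apply/negP => /lJ; rewrite inE eqxx.
move: ul => /=; rewrite inE negb_or => /andP[/andP[jk jl] /andP[kl ul]].
have sum0 (l' : seq 'I_n) : 0 < 1 + \sum_(i <- l') c i ^+ 2.
  by rewrite ltr_pwDl// sumr_ge0// => i _; exact: sqr_ge0.
have kJ : k \notin J by apply/negP => /lJ; rewrite !inE eqxx orbT.
transitivity (P
  ((fun w => (eps j w + \sum_(i <- l) c i * eps i w) + c k * eps k w)
   @^-1` A `&` coord_event eps J B)).
  congr (P (_ `&` _)); apply/seteqP; split => w /=;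
    by rewrite big_cons [c k * _ + _]addrC addrA.
have sqrt_gt0 l' : 0 < sigma * Num.sqrt (1 + \sum_(i <- l') c i ^+ 2).
  by rewrite mulr_gt0// sqrtr_gt0.
apply: (@normal_sum_restr _ _ _ _ _ _ _
  (sigma * Num.sqrt (1 + \sum_(i <- l) c i ^+ 2)) sigma) => //.
- exact: measurable_coord_event.
- apply: measurable_funD => //; apply: measurable_sum => i.
  exact: measurable_funM.
- rewrite !exprMn !sqr_sqrtr ?ltW// big_cons; ring.
move=> D D' mD mD'.
(* The constraint on [eps k] joins the coordinate event, so the induction hypothesis is used with
   [k |: J]; independence then splits it off again. *)
rewrite coord_eventU1// IH//.
- by rewrite -coord_eventU1// (isotropic_gaussian_setU1 iso).
- by rewrite /= jl.
- move=> i; rewrite in_setU1 => /orP[/eqP ->|/lJ].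
    by rewrite inE negb_or eq_sym jk.
  by rewrite !inE !negb_or => /and3P[-> _ ->].
- by move=> i; case: ifP.
Qed.

(** * Tail of a Gaussian linear form *)

(** Dividing by a nonzero coefficient [x j] gives [eps j] the coefficient 1 that
    [normal_linear_comb] asks for; the threshold is rescaled by [|x j|] accordingly. *)
Lemma gaussian_linear_form_tail (R : realType) d (T : measurableType d)
    (P : probability T R) (n : nat) (sigma : R) (eps : 'I_n -> {RV P >-> R})
    (x : 'I_n -> R) (t : R) :
  0 < sigma -> isotropic_gaussian sigma eps ->
  0 < \sum_i x i ^+ 2 -> 0 <= t ->
  (P [set w | (t < `|\sum_i x i * eps i w|)%R] <=
   (expR (- t ^+ 2 / ((sigma ^+ 2 * \sum_i x i ^+ 2) *+ 2)))%:E)%E.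
Proof.
move=> s0 iso x0 t0.
have [j xj] : exists j, x j != 0.
  apply/existsP; apply: contraTT x0 => /existsPn h; rewrite -leNgt.
  by rewrite big1// => i _; move: (h i); rewrite negbK => /eqP ->; rewrite expr0n.
pose l := [seq i <- index_enum 'I_n | i != j].
pose c i := x i / x j.
pose Y w := eps j w + \sum_(i <- l) c i * eps i w.
have xY w : \sum_i x i * eps i w = x j * Y w.
  rewrite (bigD1 j)//= mulrDr mulr_sumr big_filter; congr (_ + _).
  by apply: eq_bigr => i _; rewrite /c; field.
have xc : \sum_i x i ^+ 2 = x j ^+ 2 * (1 + \sum_(i <- l) c i ^+ 2).
  rewrite (bigD1 j)//= mulrDr mulr1 mulr_sumr big_filter; congr (_ + _).
  by apply: eq_bigr => i _; rewrite /c; field.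
have xj0 : 0 < `|x j| by rewrite normr_gt0.
have c0 : 0 < 1 + \sum_(i <- l) c i ^+ 2.
  by rewrite ltr_pwDl// sumr_ge0// => i _; exact: sqr_ge0.
have mt : measurable [set u : R | t / `|x j| < `|u|].
  rewrite (_ : [set _ | _] = (fun u => `|u|) @^-1` `]t / `|x j|, +oo[%classic).
    by apply: measurable_preimageT.
  by apply/seteqP; split => u/=; rewrite in_itv/= andbT.
(* With no constrained coordinates the accompanying event is the whole space. *)
have := @normal_linear_comb _ _ _ P n sigma eps c j l finset.set0 (fun=> setT)
  [set u : R | t / `|x j| < `|u|] s0 iso.
have -> : coord_event eps finset.set0 (fun=> setT) = setT.
  by apply/seteqP; split => // w _ i; rewrite inE.
rewrite probability_setT mule1 setIT => h.
have -> : [set w | t < `|\sum_i x i * eps i w|] =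
    Y @^-1` [set u : R | t / `|x j| < `|u|].
  apply/seteqP; split => w /=; by rewrite xY normrM ltr_pdivrMr// mulrC.
rewrite /Y h//=.
- have -> : - t ^+ 2 / ((sigma ^+ 2 * \sum_i x i ^+ 2) *+ 2) =
      - (t / `|x j|) ^+ 2 /
        ((sigma * Num.sqrt (1 + \sum_(i <- l) c i ^+ 2)) ^+ 2 *+ 2).
    rewrite xc !exprMn sqr_sqrtr ?ltW// exprVn real_normK ?num_real//.
    by field; rewrite xj !gt_eqF.
  apply: normal_prob_tail; first by rewrite mulr_gt0// sqrtr_gt0.
  by rewrite divr_ge0.
- by rewrite filter_uniq ?index_enum_uniq// mem_filter eqxx.
- by move=> i; rewrite inE.
Qed.

(** * Deterministic inequalities for a refitting *)

Lemma l2norm_sqr (R : realType) m (v : 'cV[R]_m) :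
  l2norm v ^+ 2 = \sum_i v i ord0 ^+ 2.
Proof. by rewrite sqr_sqrtr// sumr_ge0// => i _; exact: sqr_ge0. Qed.

(** Both residuals contain the same noise [e], so its squared norm cancels. The two cross terms
    combine, by linearity and a swap of sums, into the pairing of [bbar - bhat] with the transpose
    of [X] applied to [e]. *)
Lemma refitting_basic_inequality (R : realType) (n p : nat)
    (X : 'M[R]_(n, p)) (b bhat bbar : 'cV[R]_p) (e : 'cV[R]_n) :
  is_refitting X (X *m b + e) bhat bbar ->
  l2norm (X *m (b - bbar)) ^+ 2 <=
  l2norm (X *m (b - bhat)) ^+ 2 +
  2 * \sum_j (bbar - bhat) j ord0 * \sum_i X i j * e i ord0.
Proof.
rewrite /is_refitting => h.
have {h} : l2norm (X *m b + e - X *m bbar) ^+ 2 <=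
    l2norm (X *m b + e - X *m bhat) ^+ 2.
  by rewrite lerXn2r// ?nnegrE ?sqrtr_ge0.
have sq g : l2norm (X *m b + e - X *m g) ^+ 2 = l2norm (X *m (b - g)) ^+ 2 +
    2 * (\sum_i (X *m (b - g)) i ord0 * e i ord0) + \sum_i e i ord0 ^+ 2.
  rewrite !l2norm_sqr mulr_sumr -!big_split/=; apply: eq_bigr => i _.
  by rewrite mulmxBr !mxE; ring.
rewrite !sq.
have -> : \sum_j (bbar - bhat) j ord0 * (\sum_i X i j * e i ord0) =
    \sum_i (X *m (b - bhat)) i ord0 * e i ord0 -
    \sum_i (X *m (b - bbar)) i ord0 * e i ord0.
  rewrite -sumrB; under eq_bigr do rewrite mulr_sumr.
  rewrite exchange_big/=; apply: eq_bigr => i _.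
  rewrite !mxE -mulrBl -sumrB mulr_suml; apply: eq_bigr => j _.
  by rewrite !mxE; ring.
lra.
Qed.

Lemma sum_le_l1norm (R : realType) (p : nat) (v : 'cV[R]_p) (a : 'I_p -> R)
    (M : R) :
  (forall j, `|a j| <= M) -> \sum_j v j ord0 * a j <= M * l1norm v.
Proof.
move=> aM; rewrite /l1norm mulr_sumr; apply: ler_sum => j _.
rewrite (le_trans (ler_norm _))// normrM mulrC ler_wpM2r//.
Qed.

(** * Union bound and conclusion *)

Lemma measure_bigsetU_le (R : realType) d (T : measurableType d)
    (m : {measure set T -> \bar R}) (I : Type) (r : seq I) (F : I -> set T) :
  (forall i, measurable (F i)) ->
  (m (\big[setU/set0]_(i <- r) F i) <= \sum_(i <- r) m (F i))%E.
Proof.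
move=> mF; elim: r => [|i r IH]; first by rewrite !big_nil measure0.
rewrite !big_cons; apply: (le_trans (measureU2 _ _ _)) => //.
  exact: bigsetU_measurable.
by rewrite leeD2l.
Qed.

Theorem theorem2 (R : realType) (d : measure_display) (T : measurableType d)
    (P : probability T R) (n p : nat) (hn : (0 < n)%N) (hp : (0 < p)%N)
    (X : 'M[R]_(n, p))
    (hX : forall j : 'I_p, l2norm (col j X) ^+ 2 = n%:R)
    (betastar : 'cV[R]_p) (sigma : R) (hsigma : 0 < sigma)
    (eps : 'I_n -> {RV P >-> R}) (heps : isotropic_gaussian sigma eps)
    (y : T -> 'cV[R]_n)
    (hy : forall w : T, y w = X *m betastar + \col_(i < n) eps i w)
    (delta : R) (hdelta : 0 < delta < 1)
    (lambda : R)
    (hlambda : lambda = 2 * sigma * Num.sqrt (2 * ln (p%:R / delta) / n%:R))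
    (betahat betabar : T -> 'cV[R]_p)
    (hhat : forall w : T, is_lasso_solution X (y w) lambda (betahat w))
    (hbar : forall w : T, is_refitting X (y w) (betahat w) (betabar w)) :
  with_prob_ge P (1 - delta)
    [set w | n%:R^-1 * l2norm (X *m (betastar - betabar w)) ^+ 2 <=
             n%:R^-1 * l2norm (X *m (betastar - betahat w)) ^+ 2 +
             lambda * l1norm (betabar w - betahat w)].
Proof.
have n0 : 0 < n%:R :> R by rewrite ltr0n.
have p0 : 0 < p%:R :> R by rewrite ltr0n.
have /andP[d0 d1] := hdelta.
have p1 : 1 <= p%:R :> R by rewrite ler1n.
(* This makes the logarithm nonnegative, so the square root in [lambda] is a genuine one and not the
   default 0. *)
have pd : 1 < p%:R / delta by rewrite ltr_pdivlMr// mul1r (lt_le_trans d1).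
have ln0 : 0 <= ln (p%:R / delta) by rewrite ln_ge0// ltW.
have l0 : 0 <= lambda by rewrite hlambda mulr_ge0// mulr_ge0// ltW.
have l2 : lambda ^+ 2 = 8 * sigma ^+ 2 * ln (p%:R / delta) / n%:R.
  rewrite hlambda exprMn sqr_sqrtr; first by field; rewrite gt_eqF.
  by rewrite divr_ge0 ?ler0n// mulr_ge0.
pose N j w := \sum_i X i j * eps i w.
have mN j : measurable_fun setT (N j).
  by apply: measurable_sum => i; exact: measurable_funM.
(* Half of n lambda, to offset the factor 2 of the cross term in the basic inequality. *)
pose t := n%:R * lambda / 2.
have t0 : 0 <= t by rewrite divr_ge0// mulr_ge0// ltW.
pose bad j := [set w | t < `|N j w|].
have mbad j : measurable (bad j).
  rewrite (_ : bad j = (fun w => `|N j w|) @^-1` `]t, +oo[%classic).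
    apply: measurable_preimageT => //.
    by apply: measurableT_comp (mN j).
  by apply/seteqP; split => w/=; rewrite in_itv/= andbT.
have Pbad j : (P (bad j) <= (delta / p%:R)%:E)%E.
  have sx : \sum_i X i j ^+ 2 = n%:R.
    by rewrite -(hX j) l2norm_sqr; apply: eq_bigr => i _; rewrite mxE.
  apply: (le_trans (gaussian_linear_form_tail hsigma heps _ t0)).
    by rewrite sx.
  rewrite sx lee_fin.
  (* The constant in [lambda] is calibrated here: t^2 / (2 sigma^2 n) = n lambda^2 / (8 sigma^2) =
     log(p / delta). *)
  have -> : - t ^+ 2 / ((sigma ^+ 2 * n%:R) *+ 2) = - ln (p%:R / delta).
    rewrite /t exprMn exprMn l2; field.
    by rewrite !gt_eqF.
  by rewrite expRN lnK ?posrE ?divr_gt0// invf_div.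
(* The witness is defined from [eps] and [X] alone, so it is measurable however [betahat] and
   [betabar] are selected. *)
exists (~` \big[setU/set0]_j bad j); split.
- by apply: measurableC; exact: bigsetU_measurable.
- move=> w; rewrite -bigcup_seq /= => good.
  have Nt j : `|N j w| <= t.
    rewrite leNgt; apply/negP => bj; apply: good; exists j => //=.
    by rewrite mem_index_enum.
  have := hbar w; rewrite hy => /refitting_basic_inequality hle.
  rewrite -lerBlDl -mulrBr mulrC ler_pdivrMr// lerBlDl.
  apply: (le_trans hle); rewrite lerD2l.
  under eq_bigr do under eq_bigr do rewrite mxE.
  have := sum_le_l1norm (betabar w - betahat w) Nt.
  rewrite /t /N; lra.
- rewrite probability_setC; last exact: bigsetU_measurable.
  rewrite EFinB leeB//.
  apply: (le_trans (measure_bigsetU_le _ _ mbad)).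
  apply: (@le_trans _ _ (\sum_(j < p) (delta / p%:R)%:E)%E).
    by apply: lee_sum => j _; exact: Pbad.
  by rewrite sumEFin sumr_const card_ord -(mulr_natr (_ / _)) divfK// gt_eqF.
Qed.
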